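(* Let $(W\xrightarrow{\mathfrak T}\mathfrak h,\phi,\varphi)$ be a representation of a Lie-Leibniz triple $((\mathfrak g,[\cdot,\cdot]_{\mathfrak g}),(V;\rho),T)$, and let $\mathfrak C^n(\mathfrak g,\rho,T,\phi,\varphi,\mathfrak T)$ and $\mathcal D_R:\mathfrak C^n(\mathfrak g,\rho,T,\phi,\varphi,\mathfrak T)\to\mathfrak C^{n+1}(\mathfrak g,\rho,T,\phi,\varphi,\mathfrak T)$ be as defined in the context. Then $\big(\bigoplus_{n\ge0}\mathfrak C^n(\mathfrak g,\rho,T,\phi,\varphi,\mathfrak T),\mathcal D_R\big)$ is a cochain complex, i.e. $\mathcal D_R\circ\mathcal D_R=0$.
   Context: A Lie-Leibniz triple $((\mathfrak g,[\cdot,\cdot]_{\mathfrak g}),(V;\rho),T)$ consists of a Lie algebra $\mathfrak g$ over a field, a representation $\rho:\mathfrak g\to\mathfrak{gl}(V)$, and a linear map $T:V\to\mathfrak g$ with $[Tu,Tv]_{\mathfrak g}=T(\rho(Tu)v)$ for all $u,v\in V$. Representations: let $\mathfrak T:W\to\mathfrak h$ be a linear map of vector spaces (a 2-term complex). $\mathrm{End}(W\xrightarrow{\mathfrak T}\mathfrak h)=\{(A_0,A_1)\in\mathfrak{gl}(\mathfrak h)\oplus\mathfrak{gl}(W): A_0\circ\mathfrak T=\mathfrak T\circ A_1\}$ is a Lie algebra under the commutator; it acts on $\mathrm{Hom}(\mathfrak h,W)$ by $[(A_0,A_1),\Phi]_C=A_1\circ\Phi-\Phi\circ A_0$, and $\overline{\mathfrak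 T}:\mathrm{Hom}(\mathfrak h,W)\to\mathrm{End}(W\xrightarrow{\mathfrak T}\mathfrak h)$ is $\overline{\mathfrak T}(\Phi)=(\mathfrak T\circ\Phi,\Phi\circ\mathfrak T)$. A representation $(W\xrightarrow{\mathfrak T}\mathfrak h,\phi,\varphi)$ of the Lie-Leibniz triple consists of a Lie algebra homomorphism $\phi=(\phi_{\mathfrak h},\phi_W):\mathfrak g\to\mathrm{End}(W\xrightarrow{\mathfrak T}\mathfrak h)$ and a linear map $\varphi:V\to\mathrm{Hom}(\mathfrak h,W)$ with $\overline{\mathfrak T}\circ\varphi=\phi\circ T$ and $\varphi(\rho(x)u)=[\phi(x),\varphi(u)]_C$ for $x\in\mathfrak g,u\in V$. Cochains: $\mathfrak C^0=0$ and for $n\ge1$, $\mathfrak C^n(\mathfrak g,\rho,T,\phi,\varphi,\mathfrak T)=\mathrm{Hom}(\wedge^n\mathfrak g,\mathfrak h)\oplus\mathrm{Hom}(\wedge^{n-1}\mathfrak g\otimes V,W)\oplus\mathrm{Hom}(\otimes^{n-1}V,\mathfrak h)$. For $f=(f_{\mathfrak g},f_V)$ in the first two summands and $\theta$ in the third, $\mathcal D_R(f,\theta)=(\delta f,\partial\theta+\Omega f)$, where $\delta f=((\delta f)_{\mathfrak g},(\delta f)_V)$, $(\delta f)_{\mathfrak g}$ is the Chevalley-Eilenberg coboundary of $f_{\mathfrak g}$ with coefficients in $(\mathfrak h,\phi_{\mathfrak h})$, $$\begin{aligned}(\delta f)_V(x_1,\dots,x_n,v)=&\sum_{1\le i<j\le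 n}(-1)^if_V(x_1,\dots,\hat x_i,\dots,x_{j-1},[x_i,x_j]_{\mathfrak g},x_{j+1},\dots,x_n,v)+(-1)^n\varphi(v)f_{\mathfrak g}(x_1,\dots,x_n)\\&+\sum_{i=1}^n(-1)^{i+1}\big(\phi_W(x_i)f_V(x_1,\dots,\hat x_i,\dots,x_n,v)-f_V(x_1,\dots,\hat x_i,\dots,x_n,\rho(x_i)v)\big),\end{aligned}$$ $$\begin{aligned}\partial\theta(u_1,\dots,u_n)=&\sum_{i=1}^n(-1)^{i+1}\phi_{\mathfrak h}(Tu_i)\theta(u_1,\dots,\hat u_i,\dots,u_n)+(-1)^n\mathfrak T\big(\varphi(u_n)(\theta(u_1,\dots,u_{n-1}))\big)\\&+\sum_{1\le i<j\le n}(-1)^i\theta(u_1,\dots,\hat u_i,\dots,u_{j-1},\rho(Tu_i)u_j,u_{j+1},\dots,u_n),\end{aligned}$$ $$\Omega(f_{\mathfrak g},f_V)(u_1,\dots,u_n)=(-1)^n\big(f_{\mathfrak g}(Tu_1,\dots,Tu_n)-\mathfrak Tf_V(Tu_1,\dots,Tu_{n-1},u_n)\big).$$ *)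

(* Defs.v *)
From HB Require Import structures.
From mathcomp Require Import all_boot all_algebra.
(* [functions] equips [T -> M] with its pointwise lmodType structure. *)
From mathcomp Require Import functions.

Set Implicit Arguments.
Unset Strict Implicit.
Unset Printing Implicit Defensive.

Import GRing.Theory.
Local Open Scope ring_scope.

HB.mixin Record Lmodule_isLieAlgebra (K : fieldType) g of GRing.Lmodule K g := {
  bracket : g -> g -> g;
  bracket_linearl : forall y, linear (bracket^~ y);
  bracket_linearr : forall x, linear (bracket x);
  bracketxx : forall x, bracket x x = 0;
  jacobi : forall x y z,
    bracket x (bracket y z) + bracket y (bracket z x)
      + bracket z (bracket x y) = 0
}.

#[short(type="lieAlgType")]
HB.structure Definition LieAlgebra (K : fieldType) :=
  { g of GRing.Lmodule K g & Lmodule_isLieAlgebra K g }.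

(* Lie algebra homomorphisms g -> gl(V) for the commutator bracket of gl(V). *)
Definition is_lie_rep (K : fieldType) (g : lieAlgType K) (V : lmodType K)
    (rho : g -> {linear V -> V}) : Prop :=
  (forall v, linear (fun x => rho x v)) /\
  (forall x y v, rho (bracket x y) v = rho x (rho y v) - rho y (rho x v)).

Record lie_leibniz_triple (K : fieldType) := LieLeibnizTriple {
  lie_alg : lieAlgType K;
  lie_mod : lmodType K;
  lie_act : lie_alg -> {linear lie_mod -> lie_mod};
  lie_actP : is_lie_rep lie_act;
  lie_op : {linear lie_mod -> lie_alg};
  lie_opP : forall u v,
    bracket (lie_op u) (lie_op v) = lie_op (lie_act (lie_op u) v)
}.

Section TwoTermComplex.
Variables (K : fieldType) (W h : lmodType K) (d : {linear W -> h}).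

Record end_complex := EndComplex {
  end0 : {linear h -> h};
  end1 : {linear W -> W};
  endP : forall w, end0 (d w) = d (end1 w)
}.

Definition commC (A : end_complex) (Phi : h -> W) : h -> W :=
  fun y => end1 A (Phi y) - Phi (end0 A y).

Definition dbar (Phi : h -> W) : (h -> h) * (W -> W) :=
  (d \o Phi, Phi \o d).

End TwoTermComplex.

(* As the operations of End(W -> h) are componentwise, phi is a homomorphism of
   Lie algebras iff its two components are representations. *)
Record representation (K : fieldType) (L : lie_leibniz_triple K) :=
  Representation {
  rep_W : lmodType K;
  rep_h : lmodType K;
  rep_d : {linear rep_W -> rep_h};
  phi : lie_alg L -> end_complex rep_d;
  phi_hP : is_lie_rep (fun x => end0 (phi x));
  phi_WP : is_lie_rep (fun x => end1 (phi x));
  varphi : lie_mod L -> {linear rep_h -> rep_W};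
  varphi_linear : forall y, linear (fun u => varphi u y);
  dbar_varphi : forall u,
    dbar rep_d (varphi u)
      = (end0 (phi (lie_op L u)) : rep_h -> rep_h,
         end1 (phi (lie_op L u)) : rep_W -> rep_W);
  varphi_act : forall x u,
    varphi (lie_act x u) = commC (phi x) (varphi u) :> (rep_h -> rep_W)
}.

Section Arguments.
Variable T : Type.

Definition upd n (x : 'I_n -> T) (i : 'I_n) (y : T) : 'I_n -> T :=
  fun k => if k == i then y else x k.

Definition omit n (x : 'I_n.+1 -> T) (i : 'I_n.+1) : 'I_n -> T :=
  fun k => x (lift i k).

(* (x_1, .., ^x_i, .., x_(j-1), y, x_(j+1), ..) *)
Definition omit_upd n (x : 'I_n.+1 -> T) (i j : 'I_n.+1) (y : T) : 'I_n -> T :=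
  omit (upd x j y) i.

Definition fcons n (y : T) (x : 'I_n -> T) : 'I_n.+1 -> T :=
  fun k => if unlift ord0 k is Some k' then x k' else y.

End Arguments.

Section Multilinear.
Variables (K : fieldType) (U M : lmodType K) (n : nat).

Definition multilinear (f : ('I_n -> U) -> M) : Prop :=
  forall x i, linear (fun y => f (upd x i y)).

(* Hom(/\^n U, M) *)
Definition alternating (f : ('I_n -> U) -> M) : Prop :=
  multilinear f /\ (forall x i j, i != j -> x i = x j -> f x = 0).

End Multilinear.

Section Complex.
Variables (K : fieldType) (L : lie_leibniz_triple K) (R : representation L).

Local Notation g := (lie_alg L).
Local Notation V := (lie_mod L).
Local Notation rho := (@lie_act K L).
Local Notation T := (lie_op L).
Local Notation W := (rep_W R).
Local Notation h := (rep_h R).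
Local Notation d := (rep_d R).
Local Notation phi_h x := (end0 (phi R x)).
Local Notation phi_W x := (end1 (phi R x)).

(* Since C^0 = 0 has its own shape, C^n is described for n = m.+1.  Arguments are
   numbered from 0, so the sign (-1)^i of a 1-based formula becomes
   (-1) ^+ i.+1. *)

Definition maps (m : nat) : lmodType K :=
  ((('I_m.+1 -> g) -> h) * (('I_m -> g) -> V -> W) * (('I_m -> V) -> h))%type.

Definition cochain_space (n : nat) : lmodType K :=
  if n is m.+1 then maps m else 'rV[K]_0.

Definition is_cochain (n : nat) : cochain_space n -> Prop :=
  match n with
  | 0 => fun=> True
  | m.+1 => fun c : maps m =>
    [/\ alternating c.1.1,
        (forall v, alternating (fun x => c.1.2 x v))
          /\ (forall x, linear (c.1.2 x)) &
        multilinear c.2]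
  end.

Section Differential.
Variable m : nat.
Implicit Types (fg : ('I_m.+1 -> g) -> h) (fV : ('I_m -> g) -> V -> W)
  (theta : ('I_m -> V) -> h).

(* Chevalley-Eilenberg coboundary: the pairs i < j' of arguments are the
   (i, j' = lift i j) with i <= j, for which j' = j.+1. *)
Definition delta_g fg : ('I_m.+2 -> g) -> h := fun x =>
  \sum_(i < m.+2) (-1) ^+ i *: phi_h (x i) (fg (omit x i))
  + \sum_(i < m.+2) \sum_(j < m.+1 | (i <= j)%N)
      (-1) ^+ (i + j.+1)
        *: fg (fcons (bracket (x i) (x (lift i j))) (omit (omit x i) j)).

Definition delta_V fg fV : ('I_m.+1 -> g) -> V -> W := fun x v =>
  \sum_(i < m.+1) \sum_(j < m.+1 | (i < j)%N)
    (-1) ^+ i.+1 *: fV (omit_upd x i j (bracket (x i) (x j))) v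
  + (-1) ^+ m.+1 *: varphi R v (fg x)
  + \sum_(i < m.+1)
      (-1) ^+ i *: (phi_W (x i) (fV (omit x i) v)
                    - fV (omit x i) (rho (x i) v)).

Definition partial theta : ('I_m.+1 -> V) -> h := fun u =>
  \sum_(i < m.+1) (-1) ^+ i *: phi_h (T (u i)) (theta (omit u i))
  + (-1) ^+ m.+1 *: d (varphi R (u ord_max) (theta (omit u ord_max)))
  + \sum_(i < m.+1) \sum_(j < m.+1 | (i < j)%N)
      (-1) ^+ i.+1 *: theta (omit_upd u i j (rho (T (u i)) (u j))).

Definition Omega fg fV : ('I_m.+1 -> V) -> h := fun u =>
  (-1) ^+ m.+1 *: (fg (T \o u) - d (fV (omit (T \o u) ord_max) (u ord_max))).

End Differential.

Definition D_R (n : nat) : cochain_space n -> cochain_space n.+1 :=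
  match n with
  | 0 => fun=> 0
  | m.+1 => fun c : maps m =>
    (delta_g c.1.1, delta_V c.1.1 c.1.2, partial c.2 + Omega c.1.1 c.1.2)
  end.

End Complex.

(* The cochain complex with the subspaces C n of X n as components. *)
Definition is_cochain_complex (K : fieldType) (X : nat -> lmodType K)
    (C : forall n, X n -> Prop) (D : forall n, X n -> X n.+1) : Prop :=
  [/\ forall n, C n 0 /\
        (forall a (c c' : X n), C n c -> C n c' -> C n (a *: c + c')),
      forall n (c : X n), C n c -> C n.+1 (D n c),
      forall n a (c c' : X n), C n c -> C n c' ->
        D n (a *: c + c') = a *: D n c + D n c' &
      forall n (c : X n), C n c -> D n.+1 (D n c) = 0].

(* Main.v *)
Require Import Defs.
From HB Require Import structures.
From mathcomp Require Import all_boot all_algebra functions.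
From mathcomp Require Import boolp.

(* Since [d (varphi u y) = phi_h (T u) y], the three coboundaries are all
   instances of the Loday-Pirashvili differential of a left Leibniz algebra with
   coefficients in a bimodule (up to the term [varphi v (fg x)] of [delta_V]):
   the right action is zero for [delta_g] and [delta_V], the latter with
   coefficients in [Hom(V, W)], and equals the left one for [partial].  Writing
   [ins x] for the insertion of [x] as first argument and [lie_der x] for the Lie
   derivative, this differential D satisfies Cartan's formula
   [ins x (D F) = lie_der x F - D (ins x F)], and
   [ins z (lie_der x F) = lie_der x (ins z F) - ins [x, z] F].  Everything, notably
   D (D F) = 0 and the fact that Omega intertwines the differentials, then
   follows by induction on the number of arguments. *)

Set Implicit Arguments.
Unset Strict Implicit.
Unset Printing Implicit Defensive.

Import GRing.Theory.
Local Open Scope ring_scope.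

(** * Tuples with an entry prepended, omitted or replaced *)

Section Tuples.
Variable T : Type.

Lemma fcons0 n a (y : 'I_n -> T) : fcons a y ord0 = a.
Proof. by rewrite /fcons unlift_none. Qed.

Lemma fconsS n a (y : 'I_n -> T) k : fcons a y (lift ord0 k) = y k.
Proof. by rewrite /fcons liftK. Qed.

Lemma omit_fcons0 n a (y : 'I_n -> T) : omit (fcons a y) ord0 = y.
Proof. by apply/funext => k; rewrite /omit fconsS. Qed.

Lemma fcons_omit0 n (y : 'I_n.+1 -> T) : fcons (y ord0) (omit y ord0) = y.
Proof.
by apply/funext => k; case: (unliftP ord0 k) => [j|] ->; rewrite ?fconsS ?fcons0.
Qed.

Lemma lift_liftS n (i : 'I_n.+1) (k : 'I_n) :
  lift (lift ord0 i) (lift ord0 k) = lift ord0 (lift i k).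
Proof. by apply/val_inj; rewrite /= /bump /= !add1n ltnS addnS. Qed.

Lemma lift_lift0 n (i : 'I_n.+1) :
  lift (lift ord0 i) ord0 = ord0 :> 'I_n.+2.
Proof. exact/val_inj. Qed.

Lemma omit_fconsS n a (y : 'I_n.+1 -> T) i :
  omit (fcons a y) (lift ord0 i) = fcons a (omit y i).
Proof.
apply/funext => k; case: (unliftP ord0 k) => [j|] ->.
  by rewrite /omit lift_liftS !fconsS.
by rewrite /omit lift_lift0 !fcons0.
Qed.

Lemma upd_fcons0 n a (y : 'I_n -> T) b : upd (fcons a y) ord0 b = fcons b y.
Proof.
apply/funext => k; case: (unliftP ord0 k) => [j|] ->.
  by rewrite /upd !fconsS.
by rewrite /upd eqxx fcons0.
Qed.

Lemma upd_fconsS n a (y : 'I_n -> T) i b :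
  upd (fcons a y) (lift ord0 i) b = fcons a (upd y i b).
Proof.
apply/funext => k; case: (unliftP ord0 k) => [j|] ->.
  by rewrite /upd !fconsS (inj_eq lift_inj).
by rewrite /upd (negbTE (neq_lift _ _)) !fcons0.
Qed.

Lemma upd_id n (y : 'I_n -> T) i : upd y i (y i) = y.
Proof. by apply/funext => k; rewrite /upd; case: eqP => [->|]. Qed.

Lemma omit_upd_lift n (y : 'I_n.+1 -> T) i j b :
  omit_upd y i (lift i j) b = upd (omit y i) j b.
Proof. by apply/funext => k; rewrite /omit_upd /omit /upd (inj_eq lift_inj). Qed.

Lemma fcons_max n a (y : 'I_n.+1 -> T) : fcons a y ord_max = y ord_max.
Proof.
by rewrite (_ : ord_max = lift ord0 ord_max) ?fconsS //; apply/val_inj.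
Qed.

Lemma omit_fcons_max n a (y : 'I_n.+1 -> T) :
  omit (fcons a y) ord_max = fcons a (omit y ord_max).
Proof.
rewrite (_ : ord_max = lift ord0 ord_max) ?omit_fconsS //; exact/val_inj.
Qed.

End Tuples.

Lemma comp_fcons (T U : Type) (f : T -> U) n a (y : 'I_n -> T) :
  f \o fcons a y = fcons (f a) (f \o y).
Proof.
by apply/funext => k /=; case: (unliftP ord0 k) => [j|] ->;
  rewrite ?fconsS ?fcons0.
Qed.

(** * Insertion of a first argument into multilinear and alternating maps *)

Section Multilinearity.
Variables (K : fieldType) (U M : lmodType K).

Definition ins n (a : U) (F : ('I_n.+1 -> U) -> M) : ('I_n -> U) -> M :=
  fun y => F (fcons a y).

(** A nonempty tuple is its head prepended to its tail. This opens the inductions below: an identity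
    between operators reduces to one between their insertions, which Cartan's formula computes. *)
Lemma eq_ins n (F G : ('I_n.+1 -> U) -> M) :
  (forall a, ins a F = ins a G) -> F = G.
Proof.
move=> FG; apply/funext => y; rewrite -(fcons_omit0 y).
exact: (congr1 (fun f => f _) (FG _)).
Qed.

Lemma multilinearS n (F : ('I_n.+1 -> U) -> M) :
  multilinear F <->
  (forall a, multilinear (ins a F)) /\ (forall y, linear (fun a => ins a F y)).
Proof.
split=> [mF | [mF lF] x i c a b].
  split=> [z y i c a b | y c a b]; rewrite /ins.
    by rewrite -!upd_fconsS; apply: mF.
  have := mF (fcons 0 y) ord0 c a b; by rewrite !upd_fcons0.
rewrite -(fcons_omit0 x); case: (unliftP ord0 i) => [j|] ->.
  rewrite !upd_fconsS; exact: mF.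
rewrite !upd_fcons0; exact: lF.
Qed.

Lemma multilinear_arg0 (F : ('I_0 -> U) -> M) : multilinear F.
Proof. by move=> x []. Qed.

Lemma multilinear_ins n (F : ('I_n.+1 -> U) -> M) a :
  multilinear F -> multilinear (ins a F).
Proof. by case/multilinearS. Qed.

Lemma ins_lincomb n (F : ('I_n.+1 -> U) -> M) c a b :
  multilinear F -> ins (c *: a + b) F = c *: ins a F + ins b F.
Proof. by case/multilinearS => _ lF; apply/funext => y; apply: lF. Qed.

Lemma insD n (F : ('I_n.+1 -> U) -> M) a b :
  multilinear F -> ins (a + b) F = ins a F + ins b F.
Proof. by move=> mF; rewrite -[a]scale1r ins_lincomb // !scale1r. Qed.

Lemma multilinear_lincomb n c (F G : ('I_n -> U) -> M) :
  multilinear F -> multilinear G -> multilinear (c *: F + G).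
Proof.
move=> mF mG x i e a b.
change (c *: F (upd x i (e *: a + b)) + G (upd x i (e *: a + b)) =
  e *: (c *: F (upd x i a) + G (upd x i a))
  + (c *: F (upd x i b) + G (upd x i b))).
by rewrite mF mG !scalerDr !scalerA (mulrC e) addrACA.
Qed.

Lemma multilinear0 n : multilinear (0 : ('I_n -> U) -> M).
Proof. by move=> x i c a b; rewrite [RHS]addr0 [RHS]scaler0. Qed.

Lemma multilinearZ n c (F : ('I_n -> U) -> M) :
  multilinear F -> multilinear (c *: F).
Proof.
by move=> mF; rewrite -[_ *: F]addr0; apply/multilinear_lincomb/multilinear0.
Qed.

Lemma multilinearD n (F G : ('I_n -> U) -> M) :
  multilinear F -> multilinear G -> multilinear (F + G).
Proof. by move=> mF mG; rewrite -[F]scale1r; apply: multilinear_lincomb. Qed.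

Lemma multilinearB n (F G : ('I_n -> U) -> M) :
  multilinear F -> multilinear G -> multilinear (F - G).
Proof.
move=> mF mG; apply: multilinearD => //.
by rewrite -scaleN1r; apply: multilinearZ.
Qed.

Lemma alternating_lincomb n c (F G : ('I_n -> U) -> M) :
  alternating F -> alternating G -> alternating (c *: F + G).
Proof.
move=> [mF aF] [mG aG]; split; first exact: multilinear_lincomb.
move=> x i j ij xij; change (c *: F x + G x = 0).
by rewrite (aF x i j) // (aG x i j) // scaler0 addr0.
Qed.

Lemma alternating0 n : alternating (0 : ('I_n -> U) -> M).
Proof. by split; first exact: multilinear0. Qed.

Lemma alternatingZ n c (F : ('I_n -> U) -> M) :
  alternating F -> alternating (c *: F).
Proof.
by move=> aF; rewrite -[_ *: F]addr0; apply/alternating_lincomb/alternating0.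
Qed.

Lemma alternatingD n (F G : ('I_n -> U) -> M) :
  alternating F -> alternating G -> alternating (F + G).
Proof. by move=> aF aG; rewrite -[F]scale1r; apply: alternating_lincomb. Qed.

Lemma alternatingB n (F G : ('I_n -> U) -> M) :
  alternating F -> alternating G -> alternating (F - G).
Proof.
move=> aF aG; apply: alternatingD => //.
by rewrite -scaleN1r; apply: alternatingZ.
Qed.

Lemma alternating_ins n (F : ('I_n.+1 -> U) -> M) a :
  alternating F -> alternating (ins a F).
Proof.
move=> [mF aF]; split=> [|x i j ij xij]; first exact: multilinear_ins.
apply: (aF _ (lift ord0 i) (lift ord0 j)); rewrite ?fconsS //.
Qed.

Lemma alternating_ins2 n (F : ('I_n.+2 -> U) -> M) a :
  alternating F -> ins a (ins a F) = 0.
Proof.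
move=> [_ aF]; apply/funext => y; apply: (aF _ ord0 (lift ord0 ord0)) => //.
by rewrite fconsS !fcons0.
Qed.

(** Polarization of [alternating_ins2] at [a + b]. *)
Lemma alternating_insC n (F : ('I_n.+2 -> U) -> M) a b :
  alternating F -> ins a (ins b F) = - ins b (ins a F).
Proof.
move=> aF; have := alternating_ins2 (a + b) aF.
have [mF _] := aF; rewrite (insD a b mF).
rewrite (insD a b (multilinearD (multilinear_ins a mF)
                                (multilinear_ins b mF))).
move=> /eqP; rewrite -[ins a (_ + _)]/(ins a (ins a F) + ins a (ins b F)).
rewrite -[ins b (_ + _)]/(ins b (ins a F) + ins b (ins b F)).
by rewrite !alternating_ins2 // add0r addr0 addr_eq0 => /eqP.
Qed.

(* Moving the entry in position j to the front costs j transpositions. *)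
Lemma alternating_fcons n (F : ('I_n.+1 -> U) -> M) b (y : 'I_n.+1 -> U) j :
  alternating F -> F (fcons b (omit y j)) = (-1) ^+ j *: F (upd y j b).
Proof.
elim: n F y j => [|n IH] F y j aF; rewrite -(fcons_omit0 y).
  by rewrite !ord1 omit_fcons0 upd_fcons0 scale1r.
case: (unliftP ord0 j) => [k|] ->; last first.
  by rewrite omit_fcons0 upd_fcons0 scale1r.
rewrite omit_fconsS upd_fconsS.
rewrite -[LHS]/(ins (y ord0) (ins b F) (omit (omit y ord0) k)).
rewrite alternating_insC //.
rewrite -[LHS]/(- ins (y ord0) F (fcons b (omit (omit y ord0) k))).
rewrite IH; last exact: alternating_ins.
by rewrite /= /bump /= exprS mulN1r scaleNr.
Qed.

(** Two equal entries of the tail are handled by the alternation of [ins a F], and a repetition of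
    the head by [ins a (ins a F) = 0]. This is how the operators below are shown to preserve
    alternation. *)
Lemma alternatingS n (F : ('I_n.+2 -> U) -> M) :
  multilinear F -> (forall a, alternating (ins a F)) ->
  (forall a, ins a (ins a F) = 0) -> alternating F.
Proof.
move=> mF aF F0; split=> // x i j.
(* If the head recurs at position [k] of the tail, that entry is moved to the front of the tail, at
   the cost of the sign [(-1) ^+ k]; the head then stands twice in the two first places. *)
have F00 y k : y ord0 = y (lift ord0 k) -> F y = 0.
  move=> yk; rewrite -(fcons_omit0 y) -[LHS]/(ins (y ord0) F (omit y ord0)).
  rewrite -[omit y ord0](upd_id _ k).
  apply: (can_inj (signrZK k)); rewrite -alternating_fcons // scaler0.
  by rewrite -[X in fcons X]yk; apply: (congr1 (fun G => G _) (F0 (y ord0))).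
case: (unliftP ord0 i) => [i'|] ->; case: (unliftP ord0 j) => [j'|] ->.
- rewrite (inj_eq lift_inj) => ij xij; rewrite -(fcons_omit0 x).
  by case: (aF (x ord0)) => _; apply; first exact: ij.
- by move=> _ xij; apply: (F00 x i').
- by move=> _; apply: F00.
- by rewrite eqxx.
Qed.

Lemma alternating_arg1 (F : ('I_1 -> U) -> M) : multilinear F -> alternating F.
Proof. by move=> mF; split=> // x i j; rewrite !ord1. Qed.

Lemma alternating_arg0 (F : ('I_0 -> U) -> M) : alternating F.
Proof. by split=> [x []|x []]. Qed.

End Multilinearity.

(** * Cartan calculus of the Loday-Pirashvili differential *)

(* Both operators are locked: otherwise unification sees the sums of functions
   inside their bodies. *)
HB.lock Definition lie_der (K : fieldType) (l M : lmodType K)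
    (br : l -> l -> l) (act : l -> {linear M -> M}) n (x : l)
    (F : ('I_n -> l) -> M) : ('I_n -> l) -> M := fun y =>
  act x (F y) - \sum_(j < n) F (upd y j (br x (y j))).
Canonical lie_der_unlockable := Unlockable lie_der.unlock.

HB.lock Definition lpd (K : fieldType) (l M : lmodType K)
    (br : l -> l -> l) (act r : l -> {linear M -> M}) n
    (F : ('I_n -> l) -> M) : ('I_n.+1 -> l) -> M := fun y =>
  \sum_(i < n.+1) (-1) ^+ i *:
    (act (y i) (F (omit y i))
     - \sum_(j < n.+1 | (i < j)%N) F (omit_upd y i j (br (y i) (y j))))
  + (-1) ^+ n.+1 *: r (y ord_max) (F (omit y ord_max)).
Canonical lpd_unlockable := Unlockable lpd.unlock.

Section LodayPirashvili.
Variables (K : fieldType) (l M : lmodType K) (br : l -> l -> l).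
Variables act r : l -> {linear M -> M}.

Local Notation lie_der := (lie_der br act).
Local Notation lpd := (lpd br act r).

Lemma lie_der_is_linear n x : linear (@lie_der n x).
Proof.
move=> c F G; apply/funext => y.
rewrite unlock; change (act x (c *: F y + G y)
  - \sum_(j < n) (c *: F (upd y j (br x (y j))) + G (upd y j (br x (y j))))
  = c *: (act x (F y) - \sum_(j < n) F (upd y j (br x (y j))))
    + (act x (G y) - \sum_(j < n) G (upd y j (br x (y j))))).
by rewrite linearP big_split /= -scaler_sumr scalerBr opprD addrACA.
Qed.

HB.instance Definition _ n x :=
  GRing.isLinear.Build K (('I_n -> l) -> M) (('I_n -> l) -> M) _
    (@lie_der n x) (@lie_der_is_linear n x).

Lemma lpd_is_linear n : linear (@lpd n).
Proof.
move=> c F G; apply/funext => y.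
rewrite [RHS]/(c *: lpd F y + lpd G y) unlock [in RHS]scalerDr [RHS]addrACA.
congr (_ + _); last first.
  by rewrite -[X in r _ X]/(c *: _ + _) linearP scalerDr !scalerA mulrC.
rewrite scaler_sumr -big_split /=; apply: eq_bigr => i _.
rewrite scalerA mulrC -scalerA -scalerDr; congr (_ *: _).
rewrite -[X in act _ X]/(c *: _ + _) linearP scalerBr.
rewrite [X in _ - X = _](_ : _ = \sum_(j < n.+1 | (i < j)%N)
  (c *: F (omit_upd y i j (br (y i) (y j)))
   + G (omit_upd y i j (br (y i) (y j))))) //.
by rewrite big_split /= -scaler_sumr opprD addrACA.
Qed.

HB.instance Definition _ n :=
  GRing.isLinear.Build K (('I_n -> l) -> M) (('I_n.+1 -> l) -> M) _
    (@lpd n) (@lpd_is_linear n).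

Lemma lie_derB n x (F G : ('I_n -> l) -> M) :
  lie_der x (F - G) = lie_der x F - lie_der x G.
Proof. exact: linearB. Qed.

Lemma lpdB n (F G : ('I_n -> l) -> M) : lpd (F - G) = lpd F - lpd G.
Proof. exact: linearB. Qed.

(** The summand bracketing [x] with the first entry splits off as [ins (br x z) F]; the others leave
    the inserted [z] untouched. *)
Lemma ins_lie_der n x z (F : ('I_n.+1 -> l) -> M) :
  ins z (lie_der x F) = lie_der x (ins z F) - ins (br x z) F.
Proof.
apply/funext => y.
rewrite -[RHS]/(lie_der x (ins z F) y - F (fcons (br x z) y)).
rewrite /ins !lie_der.unlock big_ord_recl upd_fcons0 fcons0 opprD addrA -addrA.
rewrite [- F _ - _]addrC addrA; congr (_ - _ - _).
by apply: eq_bigr => j _; rewrite fconsS upd_fconsS.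
Qed.

(** Start of Cartan's formula: the only argument of [lpd F] is both first and last, so the right
    action meets [z] as well. *)
Lemma ins_lpd0 z (F : ('I_0 -> l) -> M) :
  ins z (lpd F) = lie_der z F - (fun y => r z (F y)).
Proof.
apply/funext => y; rewrite -[RHS]/(lie_der z F y - r z (F y)).
rewrite /ins lpd.unlock !lie_der.unlock big_ord_recl !big_ord0 addr0.
rewrite big_mkcond /=.
rewrite big_ord_recl big_ord0 /= !addr0 !subr0 !fcons0 scale1r.
rewrite (_ : ord_max = ord0) ?fcons0; last exact/val_inj.
by rewrite scaleN1r omit_fcons0.
Qed.

(** The summand [i = 0] is the Lie derivative. In those with [i > 0] the entry [z] stays first,
    since brackets replace later entries only; the index shift turns their signs around, and that of
    the right action too. *)
Lemma ins_lpdS n z (F : ('I_n.+1 -> l) -> M) :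
  ins z (lpd F) = lie_der z F - lpd (ins z F).
Proof.
apply/funext => y; rewrite -[RHS]/(lie_der z F y - lpd (ins z F) y).
rewrite /ins !lpd.unlock lie_der.unlock opprD addrA fcons_max.
rewrite omit_fcons_max; congr (_ + _); last first.
  by rewrite exprS mulN1r scaleNr.
rewrite big_ord_recl /=; congr (_ + _).
  rewrite scale1r omit_fcons0 fcons0 big_mkcond /= big_ord_recl /= add0r.
  congr (_ - _); apply: eq_bigr => j _.
  by rewrite fconsS /omit_upd upd_fconsS omit_fcons0.
rewrite -sumrN; apply: eq_bigr => i _; rewrite /= /bump /= exprS mulN1r scaleNr.
congr (- (_ *: (_ - _))); first by rewrite fconsS omit_fconsS.
rewrite big_mkcond big_ord_recl /= add0r -big_mkcond /=.
apply: eq_big => [j|j _]; first by rewrite /bump /= !add1n ltnS.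
by rewrite !fconsS /omit_upd upd_fconsS omit_fconsS.
Qed.

Lemma lie_der0 x (F : ('I_0 -> l) -> M) y : lie_der x F y = act x (F y).
Proof. by rewrite unlock big_ord0 subr0. Qed.

Lemma lie_der_linear n (G : ('I_n -> l) -> M) :
  (forall y, linear (br^~ y)) -> multilinear G ->
  (forall y, linear (fun x => act x (G y))) ->
  forall y, linear (fun x => lie_der x G y).
Proof.
move=> br_l mG aG y c a b; rewrite !lie_der.unlock aG scalerBr addrACA -opprD.
congr (_ - _); rewrite scaler_sumr -big_split; apply: eq_bigr => j _.
by rewrite br_l mG.
Qed.

Hypothesis br_linear_l : forall y, linear (br^~ y).
Hypothesis br_linear_r : forall x, linear (br x).
Hypothesis leibniz : forall x y z,
  br x (br y z) = br (br x y) z + br y (br x z).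

(** After insertion of [z], the terms with one derivative and one bracket cancel, and the double
    brackets match by the Leibniz identity. The action law is assumed on the values of [F] only,
    because [hom_act] will satisfy it on linear maps, inside a module of arbitrary functions. *)
Lemma lie_der_br n x y (F : ('I_n -> l) -> M) : multilinear F ->
  (forall z, act (br x y) (F z) = act x (act y (F z)) - act y (act x (F z))) ->
  lie_der (br x y) F = lie_der x (lie_der y F) - lie_der y (lie_der x F).
Proof.
elim: n F => [|n IH] F mF aF.
  apply/funext => z.
  rewrite -[RHS]/(lie_der x (lie_der y F) z - lie_der y (lie_der x F) z).
  by rewrite !lie_der0.
apply: eq_ins => z; rewrite -[RHS]/(ins z (lie_der x (lie_der y F))
   - ins z (lie_der y (lie_der x F))).
rewrite !ins_lie_der !lie_derB IH; first last.
- by move=> u; apply: aF.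
- exact: multilinear_ins.
rewrite (leibniz x y) (insD _ _ mF).
move: (lie_der x (ins (br _ _) _)) (lie_der y (ins (br _ _) _)) => B C.
move: (lie_der x _) (lie_der y (lie_der x _)) => A G.
rewrite !opprB [RHS]addrACA !addrA !subrK opprD.
by rewrite addrA subrK addrAC.
Qed.

(** Insertion of [y] on both sides leaves [lie_der_br] and the same claim for [ins y F]. With no
    arguments, what remains is the equivariance of the right action. *)
Lemma lie_der_lpd n x (F : ('I_n -> l) -> M) : multilinear F ->
  (forall a b z,
    act (br a b) (F z) = act a (act b (F z)) - act b (act a (F z))) ->
  (forall a b m, r (br a b) m = act a (r b m) - r b (act a m)) ->
  lie_der x (lpd F) = lpd (lie_der x F).
Proof.
move=> + + rP; elim: n F => [|n IH] F mF aF; apply: eq_ins => y.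
  rewrite ins_lie_der !ins_lpd0 lie_derB (lie_der_br mF) //.
  have -> : lie_der x (fun z => r y (F z))
      = (fun z => r y (lie_der x F z)) + (fun z => r (br x y) (F z)).
    apply/funext => z; rewrite -[RHS]/(r y (lie_der x F z) + r (br x y) (F z)).
    by rewrite !lie_der0 rP addrC subrK.
  move: (fun z => r y (lie_der x F z)) (fun z => r (br x y) (F z)) => S' S.
  move: (lie_der y _) (lie_der x (lie_der y _)) => G A.
  by rewrite opprD addrA opprB addrA subrK opprB addrC addrA subrK.
rewrite ins_lie_der !ins_lpdS ins_lie_der lie_derB lpdB (lie_der_br mF) //.
rewrite IH; [|exact: multilinear_ins|by move=> a b z; apply: aF].
move: (lie_der y _) (lie_der x (lie_der y _)) => G A.
move: (lpd (ins (br _ _) _)) (lpd _) => N L.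
by rewrite !opprB [LHS]addrC addrA -[N + _ + A]addrA subrK [N + G]addrC addrA.
Qed.

(** Cartan's formula and [lie_der_lpd] give [ins y (lpd (lpd F)) = lpd (lpd (ins y F))], so the
    number of arguments descends to zero. There [lpd] of [r y] applied to [F] is left over, and its
    insertions [act z (r y m) - r z (r y m)] vanish by the last hypothesis. *)
Lemma lpd_lpd n (F : ('I_n -> l) -> M) : multilinear F ->
  (forall a b z,
    act (br a b) (F z) = act a (act b (F z)) - act b (act a (F z))) ->
  (forall a b m, r (br a b) m = act a (r b m) - r b (act a m)) ->
  (forall a b m, act a (r b m) = r a (r b m)) ->
  lpd (lpd F) = 0.
Proof.
move=> + + rP rr; elim: n F => [|n IH] F mF aF; apply: eq_ins => y.
  rewrite ins_lpdS ins_lpd0 lpdB lie_der_lpd // subKr.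
  apply: eq_ins => z; rewrite ins_lpd0; apply/funext => u.
  rewrite -[LHS]/(lie_der z (fun t => r y (F t)) u - r z (r y (F u))).
  by rewrite lie_der0 rr subrr.
rewrite !ins_lpdS lpdB lie_der_lpd // IH ?subr0 ?subrr //.
- exact: multilinear_ins.
- by move=> a b z; apply: aF.
Qed.

Lemma multilinear_lie_der n x (F : ('I_n -> l) -> M) :
  multilinear F -> multilinear (lie_der x F).
Proof.
elim: n F => [|n IH] F mF; first exact: multilinear_arg0.
apply/multilinearS; split=> [z|y c a b]; rewrite ins_lie_der.
  apply: multilinearB; last exact: multilinear_ins.
  exact/IH/multilinear_ins.
rewrite !ins_lie_der (br_linear_r x) !(ins_lincomb _ _ _ mF) linearP.
rewrite -[LHS]/(_ + _ - (_ + _)) -[RHS]/(c *: (_ - _) + (_ - _)).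
by rewrite scalerBr opprD addrACA.
Qed.

(** Inserting [z] twice into [lie_der x F] leaves [ins z] and [ins (br x z)] applied to [F] in both
    orders with the same sign, and these insertions anticommute. *)
Lemma alternating_lie_der n x (F : ('I_n -> l) -> M) :
  alternating F -> alternating (lie_der x F).
Proof.
elim: n F => [|[|n] IH] F aF; first exact: alternating_arg0.
  by apply/alternating_arg1/multilinear_lie_der; case: aF.
apply: alternatingS => [|z|z]; first by apply/multilinear_lie_der; case: aF.
  rewrite ins_lie_der; apply: alternatingB; last exact: alternating_ins.
  exact/IH/alternating_ins.
rewrite ins_lie_der.
rewrite -[LHS]/(ins z (lie_der x (ins z F)) - ins z (ins (br x z) F)).
rewrite ins_lie_der alternating_ins2 // linear0 (alternating_insC z) //.
by rewrite opprK sub0r addNr.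
Qed.

Lemma multilinear_lpd n (F : ('I_n -> l) -> M) : multilinear F ->
  (forall y, linear (fun x => act x (F y))) ->
  (forall y, linear (fun x => r x (F y))) ->
  multilinear (lpd F).
Proof.
have lie_lin k (G : _ -> M) := @lie_der_linear k G br_linear_l.
elim: n F => [|n IH] F mF aF rF; apply/multilinearS; split=> [z|y c a b].
- exact: multilinear_arg0.
- rewrite !ins_lpd0 -[LHS]/(lie_der _ F y - r _ (F y)).
  rewrite -[RHS]/(c *: (lie_der a F y - r a (F y))
                  + (lie_der b F y - r b (F y))).
  by rewrite lie_lin // rF scalerBr addrACA opprD.
- rewrite ins_lpdS; apply: multilinearB; first exact: multilinear_lie_der.
  by apply: IH => [|u|u]; [exact: multilinear_ins|apply: aF|apply: rF].
- rewrite !ins_lpdS ins_lincomb // linearP.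
  rewrite -[LHS]/(lie_der _ F y - (c *: lpd (ins a F) y + lpd (ins b F) y)).
  rewrite -[RHS]/(c *: (lie_der a F y - lpd (ins a F) y)
     + (lie_der b F y - lpd (ins b F) y)).
  by rewrite lie_lin // scalerBr addrACA opprD.
Qed.

(** Inserting [z] twice produces [lie_der z (ins z F)] with both signs, besides [ins (br z z) F] and
    [lpd (ins z (ins z F))], which vanish. When [F] has one argument, the last of these is replaced
    by a right action term, zero by hypothesis. *)
Lemma alternating_lpd n (F : ('I_n -> l) -> M) : alternating F ->
  (forall x, br x x = 0) ->
  (forall y, linear (fun x => act x (F y))) ->
  (forall x y, r x (F y) = 0) ->
  alternating (lpd F).
Proof.
move=> + brxx; elim: n F => [|n IH] F aF actF rF.
  apply/alternating_arg1/multilinear_lpd; [by case: aF|exact: actF|].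
  by move=> y c a b; rewrite !rF scaler0 addr0.
apply: alternatingS => [|z|z].
- apply: multilinear_lpd; [by case: aF|exact: actF|].
  by move=> y c a b; rewrite !rF scaler0 addr0.
- rewrite ins_lpdS; apply: alternatingB; first exact: alternating_lie_der.
  by apply: IH => [|u|x u]; [exact: alternating_ins|apply: actF|apply: rF].
have [mF _] := aF.
have ins0 : ins 0 F = 0.
  by have := ins_lincomb (-1) 0 0 mF; rewrite scaler0 addr0 scaleN1r addNr.
rewrite ins_lpdS -[LHS]/(ins z (lie_der z F) - ins z (lpd (ins z F))).
rewrite ins_lie_der brxx ins0 subr0.
case: n {IH} F aF actF rF mF ins0 => [|n] F aF actF rF mF ins0.
  by rewrite ins_lpd0 opprB addrC subrK; apply/funext => u; apply: rF.
by rewrite ins_lpdS alternating_ins2 // linear0 subr0 subrr.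
Qed.

(** Serves with [P] the linearity of maps [V -> W], to show that [dV] keeps its values in
    [Hom(V, W)]. *)
Lemma lpd_closed n (P : M -> Prop) (F : ('I_n -> l) -> M) :
  P 0 -> (forall c a b, P a -> P b -> P (c *: a + b)) ->
  (forall x y, P (act x (F y))) -> (forall x y, P (r x (F y))) ->
  (forall y, P (F y)) -> forall y, P (lpd F y).
Proof.
move=> P0 PP Pa Pr PF y.
have PD a b : P a -> P b -> P (a + b).
  by move=> Pa1 Pb; rewrite -[a]scale1r; apply: PP.
have PZ c a : P a -> P (c *: a).
  by move=> Pa1; rewrite -[_ *: a]addr0; apply: PP.
rewrite unlock; apply: (PD); last exact: PZ.
apply: (big_ind P) => // i _; apply: (PZ); apply: (PD) => //.
by rewrite -scaleN1r; apply: (PZ); apply: (big_ind P).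
Qed.

End LodayPirashvili.

(** Naturality in the coefficients: [f] is linear and commutes with both actions, hence with every
    term of the differential. *)
Lemma lpd_comp (K : fieldType) (l M N : lmodType K) (br : l -> l -> l)
    (act r : l -> {linear M -> M}) (act' r' : l -> {linear N -> N})
    (f : {linear M -> N}) n (F : ('I_n -> l) -> M) :
  (forall x m, f (act x m) = act' x (f m)) ->
  (forall x m, f (r x m) = r' x (f m)) ->
  lpd br act' r' (f \o F) = f \o lpd br act r F.
Proof.
move=> fact fr; apply/funext => y; rewrite !lpd.unlock /= linearD linearZ fr.
congr (_ + _); rewrite linear_sum; apply: eq_bigr => i _.
rewrite linearZ /=; congr (_ *: _).
by rewrite linearB /= fact (linear_sum f).
Qed.

Lemma comp_upd (A B : Type) (f : A -> B) n (y : 'I_n -> A) i a :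
  f \o upd y i a = upd (f \o y) i (f a).
Proof. by apply/funext => k /=; rewrite /upd; case: eqP. Qed.

(** * The Lie bracket as a left Leibniz bracket *)

Section LieAlgebra.
Variables (K : fieldType) (g : lieAlgType K).

Lemma bracketD (x y z : g) : bracket (x + y) z = bracket x z + bracket y z.
Proof. by have := bracket_linearl z 1 x y; rewrite !scale1r. Qed.

Lemma bracketDr (x y z : g) : bracket x (y + z) = bracket x y + bracket x z.
Proof. by have := bracket_linearr x 1 y z; rewrite !scale1r. Qed.

Lemma bracketC (x y : g) : bracket x y = - bracket y x.
Proof.
have := bracketxx (x + y); rewrite bracketD !bracketDr !bracketxx add0r addr0.
by move/eqP; rewrite addr_eq0 => /eqP.
Qed.

Lemma bracketNr (x y : g) : bracket x (- y) = - bracket x y.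
Proof.
have b0 : bracket x 0 = 0.
  by apply: (addrI (bracket x 0)); rewrite -bracketDr !addr0.
by apply/eqP; rewrite -addr_eq0 -bracketDr addNr b0.
Qed.

Lemma bracket_leibniz (x y z : g) :
  bracket x (bracket y z) = bracket (bracket x y) z + bracket y (bracket x z).
Proof.
have /eqP := jacobi x y z; rewrite -addrA addr_eq0 => /eqP ->.
rewrite opprD addrC (bracketC z (bracket x y)) opprK; congr (_ + _).
by rewrite (bracketC z x) bracketNr opprK.
Qed.

End LieAlgebra.

(** * The three coboundaries as Loday-Pirashvili differentials *)

Section LieLeibnizComplex.
Variables (K : fieldType) (L : lie_leibniz_triple K) (R : representation L).

Local Notation g := (lie_alg L).
Local Notation V := (lie_mod L).
Local Notation rho := (@lie_act K L).
Local Notation T := (lie_op L).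
Local Notation W := (rep_W R).
Local Notation h := (rep_h R).
Local Notation d := (rep_d R).
Local Notation phi_h x := (end0 (phi R x)).
Local Notation phi_W x := (end1 (phi R x)).

Definition leib (u v : V) : V := rho (T u) v.

(** The usual action on [Hom(V, W)], taken on all functions because these carry the pointwise module
    structure; linearity in [V] is tracked separately. *)
Definition hom_act (x : g) (A : V -> W) : V -> W := fun v =>
  phi_W x (A v) - A (rho x v).

Lemma hom_act_is_linear x : linear (hom_act x).
Proof.
move=> c A B; apply/funext => v.
rewrite -[LHS]/(phi_W x (c *: A v + B v) - (c *: A (rho x v) + B (rho x v))).
rewrite -[RHS]/(c *: (phi_W x (A v) - A (rho x v))
                + (phi_W x (B v) - B (rho x v))).
by rewrite linearP scalerBr addrACA opprD.
Qed.

HB.instance Definition _ x :=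
  GRing.isLinear.Build K (V -> W) (V -> W) _ (hom_act x) (hom_act_is_linear x).

(** Exchanging the arguments of [varphi] gives a map of coefficients from [h] to [Hom(V, W)], so
    that the mixed term of [delta_V] becomes a composition with it. *)
Definition varphi_fun (y : h) : V -> W := fun v => varphi R v y.

Lemma varphi_fun_is_linear : linear varphi_fun.
Proof. by move=> c a b; apply/funext => v; rewrite /varphi_fun linearP. Qed.

HB.instance Definition _ :=
  GRing.isLinear.Build K h (V -> W) _ varphi_fun varphi_fun_is_linear.

Lemma d_varphi u y : d (varphi R u y) = phi_h (T u) y.
Proof. exact: (congr1 (fun p => p.1 y) (dbar_varphi R u)). Qed.

Local Notation act_h := (fun x : g => phi_h x).
Local Notation act_Hom :=
  (fun x : g => hom_act x : {linear (V -> W) -> (V -> W)}).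
Local Notation act_V := (fun u : V => phi_h (T u)).
Local Notation null_h := (fun _ : g => \0 : {linear h -> h}).
Local Notation null_Hom := (fun _ : g => \0 : {linear (V -> W) -> (V -> W)}).
Local Notation ract_V := (fun u : V => d \o varphi R u : {linear h -> h}).
Local Notation dg := (lpd (@bracket K g) act_h null_h).
Local Notation dV := (lpd (@bracket K g) act_Hom null_Hom).
Local Notation dT := (lpd leib act_V ract_V).
Local Notation lie_g := (lie_der (@bracket K g) act_h).
Local Notation lie_V := (lie_der (@bracket K g) act_Hom).
Local Notation lie_T := (lie_der leib act_V).

(** By alternation, moving the bracket from the front back to position [j] costs [(-1) ^+ j], which
    reduces the Chevalley-Eilenberg sign [(-1) ^+ (i + j.+1)] to [- (-1) ^+ i]. *)
Lemma delta_gE m (f : ('I_m.+1 -> g) -> h) : alternating f ->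
  @delta_g K L R m f = dg f.
Proof.
move=> af; apply/funext => x; rewrite /delta_g lpd.unlock scaler0 addr0.
rewrite -big_split /=; apply: eq_bigr => i _; rewrite scalerBr; congr (_ + _).
(* The index [j = i], excluded by [i < j], is split off; the remaining ones are the [lift i j]. *)
rewrite [in RHS]big_mkcond (bigD1_ord i) //= ltnn add0r.
rewrite -scalerN -sumrN scaler_sumr.
rewrite [LHS]big_mkcond; apply: eq_bigr => j _.
have -> : (i < lift i j)%N = (i <= j)%N.
  by rewrite /= /bump; case: (leqP i j) => ij;
    rewrite ?add1n ?ltnS ?add0n // ltnNge ltnW.
case: ifP => _; last by rewrite oppr0 scaler0.
rewrite alternating_fcons // omit_upd_lift scalerA scalerN -scaleNr.
by rewrite exprD exprS mulN1r mulrN mulNr -mulrA -expr2 sqrr_sign mulr1.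
Qed.

Lemma delta_VE m (f : ('I_m.+1 -> g) -> h) (fV : ('I_m -> g) -> V -> W) :
  delta_V f fV = dV fV + (-1) ^+ m.+1 *: (varphi_fun \o f).
Proof.
apply/funext => x; apply/funext => v.
rewrite -[RHS]/(dV fV x v + (-1) ^+ m.+1 *: varphi R v (f x)).
rewrite lpd.unlock scaler0 addr0 fct_sumE /delta_V addrAC; congr (_ + _).
rewrite -big_split /=; apply: eq_bigr => i _.
set S := \sum_(j < m.+1 | _) fV _.
rewrite -[RHS]/((-1) ^+ i *: (hom_act (x i) (fV (omit x i)) v - S v)).
rewrite [in RHS]scalerBr [RHS]addrC /S fct_sumE; congr (_ + _).
rewrite scaler_sumr -sumrN; apply: eq_bigr => j _.
by rewrite exprS mulN1r scaleNr.
Qed.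

Lemma partialE m (th : ('I_m -> V) -> h) : partial (R := R) th = dT th.
Proof.
apply/funext => u; rewrite /partial lpd.unlock /= addrAC; congr (_ + _).
rewrite -big_split /=; apply: eq_bigr => i _; rewrite scalerBr; congr (_ + _).
rewrite scaler_sumr -sumrN; apply: eq_bigr => j _.
by rewrite exprS mulN1r scaleNr.
Qed.

(** * [Omega] intertwines the differentials *)

(** [Omega] without its sign, which depends on the degree: in this form it commutes with insertions
    and Lie derivatives exactly. *)
Definition Omega0 n (f : ('I_n.+1 -> g) -> h) (fV : ('I_n -> g) -> V -> W) :
    ('I_n.+1 -> V) -> h := fun u =>
  f (T \o u) - d (fV (omit (T \o u) ord_max) (u ord_max)).

Lemma ins_Omega0 n u (f : ('I_n.+2 -> g) -> h) (fV : ('I_n.+1 -> g) -> V -> W) :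
  ins u (Omega0 f fV) = Omega0 (ins (T u) f) (ins (T u) fV).
Proof.
by apply/funext => y; rewrite /ins /Omega0 comp_fcons omit_fcons_max fcons_max.
Qed.

Lemma Omega0_linear n c (f f' : ('I_n.+1 -> g) -> h)
    (fV fV' : ('I_n -> g) -> V -> W) :
  Omega0 (c *: f + f') (c *: fV + fV') = c *: Omega0 f fV + Omega0 f' fV'.
Proof.
apply/funext => u.
rewrite -[RHS]/(c *: Omega0 f fV u + Omega0 f' fV' u) /Omega0.
rewrite -[LHS]/(c *: f _ + f' _ - d (c *: fV _ _ + fV' _ _)).
by rewrite linearP opprD scalerBr addrACA.
Qed.

Lemma Omega0B n (f f' : ('I_n.+1 -> g) -> h) (fV fV' : ('I_n -> g) -> V -> W) :
  Omega0 (f - f') (fV - fV') = Omega0 f fV - Omega0 f' fV'.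
Proof.
have := Omega0_linear (-1) f' f fV' fV.
by rewrite !scaleN1r ![- _ + _]addrC.
Qed.

(** [T] carries [leib] to the bracket, so both sides have the same insertions once the claim is
    known for one argument less. *)
Lemma lie_Omega0 n u (f : ('I_n.+1 -> g) -> h) (fV : ('I_n -> g) -> V -> W) :
  lie_T u (Omega0 f fV) = Omega0 (lie_g (T u) f) (lie_V (T u) fV).
Proof.
elim: n f fV => [|n IH] f fV; last first.
  apply: eq_ins => v.
  by rewrite ins_lie_der !ins_Omega0 IH !ins_lie_der Omega0B lie_opP.
(* The single argument sits in the [V] slot of [fV]: its bracket with [u] is the [rho] term of
   [hom_act], while [endP] carries the [phi_W] term across [d]. *)
apply/funext => v.
rewrite /Omega0 !lie_der.unlock !big_ord_recl !big_ord0 !addr0.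
rewrite comp_upd [leib _ _]/leib -lie_opP subr0.
set Y := fV (omit (T \o v) ord_max).
have -> : ord_max = ord0 :> 'I_1 by apply/val_inj.
rewrite /= /hom_act.
rewrite /upd eqxx !linearB /=. by rewrite endP addrACA.
Qed.

(** With no arguments only the left and right actions occur, and they agree by [d_varphi]. *)
Lemma dT0 (f : ('I_0 -> V) -> h) : dT f = 0.
Proof.
apply: eq_ins => u; rewrite ins_lpd0; apply/funext => y.
rewrite -[LHS]/(lie_T u f y - d (varphi R u (f y))).
by rewrite lie_der0 d_varphi subrr.
Qed.

(** Both terms are the action of [T u] on the value of [f], the second one by [d_varphi]. *)
Lemma Omega0_varphi0 (f : ('I_0 -> g) -> h) : Omega0 (dg f) (varphi_fun \o f) = 0.
Proof.
apply: eq_ins => u; apply/funext => y; rewrite /ins /Omega0 comp_fcons.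
rewrite -[dg f _]/(ins (T u) (dg f) (T \o y)) ins_lpd0.
rewrite -[X in X - _]/(lie_g (T u) f (T \o y) - 0) subr0 lie_der0.
rewrite /= /varphi_fun d_varphi.
have -> : omit (fcons (T u) (T \o y)) ord_max = T \o y by apply/funext; case.
have -> : ord_max = ord0 :> 'I_1 by apply/val_inj.
by rewrite fcons0 subrr.
Qed.


(** Cartan's formula on both sides reduces the claim to the insertions. The alternating sign of the
    [varphi] term agrees with the minus sign that the formula puts before [lpd]. *)
Lemma dT_Omega0 n (f : ('I_n.+1 -> g) -> h) (fV : ('I_n -> g) -> V -> W) :
  dT (Omega0 f fV) = Omega0 (dg f) (dV fV + (-1) ^+ n.+1 *: (varphi_fun \o f)).
Proof.
elim: n f fV => [|n IH] f fV; apply: eq_ins => u.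
  (* Here [ins u] uses up the only argument of [Omega0 f fV], so no induction hypothesis is
     available: [dT0] kills the remainder on the left, [Omega0_varphi0] the one on the right. *)
  have -> : ins u (Omega0 (dg f) (dV fV + (-1) ^+ 1 *: (varphi_fun \o f)))
      = Omega0 (lie_g (T u) f - dg (ins (T u) f))
           (lie_V (T u) fV - (varphi_fun \o ins (T u) f)).
    rewrite ins_Omega0 ins_lpdS; congr (Omega0 _ _); rewrite scaleN1r.
    rewrite -[LHS]/(ins (T u) (dV fV) - (varphi_fun \o ins (T u) f)) ins_lpd0.
    by congr (_ - _); apply: subr0.
  by rewrite Omega0B Omega0_varphi0 ins_lpdS dT0 !subr0 lie_Omega0.
rewrite ins_lpdS lie_Omega0 !ins_Omega0 IH ins_lpdS -Omega0B; congr (Omega0 _ _).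
rewrite [_ ^+ n.+2]exprS mulN1r scaleNr.
rewrite -[RHS]/(ins (T u) (dV fV) - _ *: (varphi_fun \o ins (T u) f)).
by rewrite ins_lpdS opprD addrA.
Qed.

(** * Module and Leibniz axioms for the three coefficient systems *)

Lemma phi_h_linear y : linear (fun x => phi_h x y).
Proof. by case: (phi_hP R) => lin _; apply: lin. Qed.

Lemma phi_h_br x y m :
  phi_h (bracket x y) m = phi_h x (phi_h y m) - phi_h y (phi_h x m).
Proof. by case: (phi_hP R) => _; apply. Qed.

Lemma phi_hT_br u v m : phi_h (T (leib u v)) m
  = phi_h (T u) (phi_h (T v) m) - phi_h (T v) (phi_h (T u) m).
Proof. by rewrite /leib -lie_opP phi_h_br. Qed.

Lemma leib_linear_l v : linear (leib^~ v).
Proof. by move=> c a b; rewrite /leib linearP; case: (lie_actP L) => ->. Qed.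

Lemma leib_linear_r u : linear (leib u).
Proof. by move=> c a b; rewrite /leib linearP. Qed.

Lemma leib_leibniz u v w :
  leib u (leib v w) = leib (leib u v) w + leib v (leib u w).
Proof. by case: (lie_actP L) => _ br; rewrite /leib -lie_opP br subrK. Qed.

(** Linearity of [A] splits [A (rho (bracket x y) v)]; the mixed terms with one [phi_W] and one
    [rho] cancel. *)
Lemma hom_act_br x y A : linear A ->
  hom_act (bracket x y) A = hom_act x (hom_act y A) - hom_act y (hom_act x A).
Proof.
move=> lA; have AB u v : A (u - v) = A u - A v.
  by have := lA (-1) v u; rewrite !scaleN1r ![- _ + _]addrC.
apply/funext => v.
rewrite -[RHS]/(phi_W x (phi_W y (A v) - A (rho y v))
    - (phi_W y (A (rho x v)) - A (rho y (rho x v)))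
  - (phi_W y (phi_W x (A v) - A (rho x v))
    - (phi_W x (A (rho y v)) - A (rho x (rho y v))))) /hom_act.
case: (phi_WP R) (lie_actP L) => _ Wbr [_ rbr].
rewrite Wbr rbr AB (linearB (phi_W x)) (linearB (phi_W y)).
rewrite !opprB [RHS]addrACA [X in _ = X + _]addrA subrK.
rewrite [X in _ = _ + X]addrA subrK.
by rewrite [RHS]addrACA [- _ - _]addrC [LHS]addrACA.
Qed.

Lemma hom_act_linear A : linear A -> linear (fun x => hom_act x A).
Proof.
move=> lA c x y; apply/funext => v.
rewrite -[RHS]/(c *: (phi_W x (A v) - A (rho x v))
                + (phi_W y (A v) - A (rho y v))).
rewrite /hom_act; case: (phi_WP R) (lie_actP L) => Wl _ [rl _].
by rewrite Wl rl lA scalerBr opprD addrACA.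
Qed.

Lemma hom_act_closed x A : linear A -> linear (hom_act x A).
Proof.
move=> lA c u v; rewrite /hom_act lA !linearP lA scalerBr opprD addrACA //.
Qed.

(** This is [varphi_act] solved for its [phi_h] term: the equivariance required by [lpd_comp]. *)
Lemma varphi_fun_act x y : varphi_fun (phi_h x y) = hom_act x (varphi_fun y).
Proof.
apply/funext => v; rewrite /hom_act /varphi_fun.
by rewrite (varphi_act R x v) /commC subKr.
Qed.

(** * Stability of cochains under the differential *)

Lemma alternating_fct m (fV : ('I_m -> g) -> V -> W) :
  alternating fV <-> forall v, alternating (fun x => fV x v).
Proof.
split=> [[mF aF] v | aF].
  split=> [x i c a b | x i j ij xij]; last by rewrite (aF x i j).
  by rewrite mF.
split=> [x i c a b | x i j ij xij]; apply/funext => v.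
  by case: (aF v) => mF _; apply: mF.
by case: (aF v) => _ a0; apply: (a0 x i j).
Qed.

Lemma alternating_varphi m (f : ('I_m -> g) -> h) :
  alternating f -> alternating (varphi_fun \o f).
Proof.
move=> [mF aF]; split=> [x i c a b | x i j ij xij] /=.
  by rewrite mF linearP.
by rewrite (aF x i j) // linear0.
Qed.

Lemma alternating_delta_g m (f : ('I_m.+1 -> g) -> h) :
  alternating f -> alternating (@delta_g K L R m f).
Proof.
move=> af; rewrite delta_gE //; apply: alternating_lpd => //.
- exact: bracket_linearl.
- exact: bracket_linearr.
- exact: bracketxx.
- by move=> y; apply: phi_h_linear.
Qed.

Lemma alternating_delta_V m f (fV : ('I_m -> g) -> V -> W) :
  alternating f -> alternating fV -> (forall x, linear (fV x)) ->
  alternating (delta_V f fV).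
Proof.
move=> af aV lV; rewrite delta_VE; apply: alternatingD.
  apply: alternating_lpd => //.
  - exact: bracket_linearl.
  - exact: bracket_linearr.
  - exact: bracketxx.
  - by move=> y; apply: hom_act_linear.
exact/alternatingZ/alternating_varphi.
Qed.

Lemma linear_delta_V m f (fV : ('I_m -> g) -> V -> W) :
  (forall x, linear (fV x)) -> forall x, linear (delta_V f fV x).
Proof.
move=> lV x; rewrite delta_VE.
have lD (A B : V -> W) e : linear A -> linear B -> linear (e *: A + B).
  move=> lA lB c u v.
  rewrite -[LHS]/(e *: A (c *: u + v) + B (c *: u + v)) lA lB.
  rewrite -[RHS]/(c *: (e *: A u + B u) + (e *: A v + B v)).
  by rewrite !scalerDr !scalerA (mulrC e) addrACA.
have l0 : linear (0 : V -> W) by move=> c u v; rewrite [RHS]addr0 [RHS]scaler0.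
rewrite addrC; apply: (lD _ _ ((-1) ^+ m.+1)).
  by move=> c u v; apply: varphi_linear.
apply: (@lpd_closed _ _ _ bracket act_Hom null_Hom _
  (fun A : V -> W => linear A)) => //.
- by move=> e A B; apply: lD.
- by move=> z y; apply: hom_act_closed.
Qed.

Lemma multilinear_Omega0 m (f : ('I_m.+1 -> g) -> h)
    (fV : ('I_m -> g) -> V -> W) :
  multilinear f -> multilinear fV -> (forall x, linear (fV x)) ->
  multilinear (Omega0 f fV).
Proof.
elim: m f fV => [|m IH] f fV mf mV lV; apply/multilinearS; split.
- by move=> a; apply: multilinear_arg0.
- move=> y c a b; rewrite /ins /Omega0 !comp_fcons.
  rewrite (_ : ord_max = ord0); last exact/val_inj.
  rewrite !fcons0 !omit_fcons0 lV (linearP T) (linearP d).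
  rewrite -[f (fcons _ _) in LHS]/(ins (c *: T a + T b) f _) ins_lincomb //.
  rewrite -[X in X - _ = _]/(c *: f _ + f _).
  by rewrite scalerBr opprD addrACA.
- move=> a; rewrite ins_Omega0; apply: IH; [exact: multilinear_ins..|].
  by move=> x; apply: lV.
- move=> y c a b; rewrite !ins_Omega0 linearP !ins_lincomb //.
  by rewrite Omega0_linear.
Qed.

Lemma OmegaE m (f : ('I_m.+1 -> g) -> h) (fV : ('I_m -> g) -> V -> W) :
  Omega f fV = (-1) ^+ m.+1 *: Omega0 f fV.
Proof. by []. Qed.

(** * Squares of the differentials and the total differential *)

Lemma varphi_comp_linear m a (f f' : ('I_m -> g) -> h) :
  varphi_fun \o (a *: f + f') = a *: (varphi_fun \o f) + (varphi_fun \o f').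
Proof. by apply/funext => x; apply: (linearP varphi_fun). Qed.

Lemma dg_dg m (f : ('I_m -> g) -> h) : multilinear f -> dg (dg f) = 0.
Proof.
move=> mf; apply: lpd_lpd => //; [
  exact: bracket_leibniz|by move=> *; apply: phi_h_br
  |by move=> * /=; rewrite linear0 subr0|by move=> * /=; rewrite linear0].
Qed.

Lemma dV_dV m (fV : ('I_m -> g) -> V -> W) :
  multilinear fV -> (forall x, linear (fV x)) -> dV (dV fV) = 0.
Proof.
move=> mf lV; apply: lpd_lpd => //; [
  exact: bracket_leibniz|by move=> *; apply: hom_act_br
  |by move=> * /=; rewrite linear0 subr0|by move=> * /=; rewrite linear0].
Qed.

Lemma dT_dT m (th : ('I_m -> V) -> h) : multilinear th -> dT (dT th) = 0.
Proof.
move=> mth; apply: lpd_lpd => //; [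
  exact: leib_leibniz|by move=> *; apply: phi_hT_br
  |by move=> * /=; rewrite !d_varphi phi_hT_br
  |by move=> * /=; rewrite !d_varphi].
Qed.

Lemma dV_varphi m (f : ('I_m -> g) -> h) :
  dV (varphi_fun \o f) = varphi_fun \o dg f.
Proof.
by apply: lpd_comp => [x y|x y]; [exact: varphi_fun_act|exact: linear0].
Qed.

Lemma D_R_linear n a (c c' : cochain_space R n) :
  is_cochain c -> is_cochain c' -> D_R (a *: c + c') = a *: D_R c + D_R c'.
Proof.
case: n c c' => [|m] c c'; first by move=> _ _; rewrite [RHS]addr0 scaler0.
case: c c' => [[f fV] th] [[f' fV'] th'].
move=> [/= af _ _] [/= af' _ _].
congr ((_, _), _) => /=.
- by rewrite !delta_gE //; [exact: linearP|exact: alternating_lincomb].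
- rewrite !delta_VE varphi_comp_linear linearP !scalerDr addrACA !scalerA.
  by rewrite (mulrC a).
- rewrite !partialE !OmegaE Omega0_linear linearP !scalerDr addrACA !scalerA.
  by rewrite (mulrC a).
Qed.

Lemma is_cochain0 n : is_cochain (0 : cochain_space R n).
Proof.
case: n => // m; split; [exact: alternating0| |exact: multilinear0].
split=> [v|x c u v]; first exact: alternating0.
by rewrite [RHS]addr0 [RHS]scaler0.
Qed.

Lemma D_R0 n : D_R (0 : cochain_space R n) = 0.
Proof.
have := D_R_linear 1 (is_cochain0 n) (is_cochain0 n).
by rewrite scaler0 add0r scale1r -{1}[D_R _]addr0 => /addrI.
Qed.

(** [D_R] is triangular, as in a mapping cone. The diagonal squares vanish; the maps
    [varphi_fun \o _] and [Omega0] commute with the differentials, the latter up to the [varphi]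
    term, and their signs change with the degree, so the mixed terms cancel. *)
Lemma D_R_D_R n (c : cochain_space R n) : is_cochain c -> D_R (D_R c) = 0.
Proof.
case: n c => [|m] c; first by move=> _; apply: (D_R0 1).
case: c => [[f fV] th] [/= af [/alternating_fct aV lV] mth].
have [[mf _] [mV _]] := (af, aV).
rewrite /D_R /=; congr ((_, _), _).
- by rewrite (delta_gE (alternating_delta_g af)) delta_gE // dg_dg.
- rewrite !delta_VE delta_gE // linearD linearZ /= dV_dV // dV_varphi add0r.
  by rewrite [_ ^+ m.+2]exprS mulN1r scaleNr subrr.
- rewrite !partialE !OmegaE linearD /= dT_dT // add0r linearZ /= dT_Omega0.
  by rewrite delta_VE delta_gE // [_ ^+ m.+2]exprS mulN1r scaleNr subrr.
Qed.

End LieLeibnizComplex.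

Theorem theorem5p13 (K : fieldType) (L : lie_leibniz_triple K)
    (R : representation L) :
  is_cochain_complex (@is_cochain K L R) (@D_R K L R).
Proof.
split=> [n|n c|n a c c'|n c]; first last.
- exact: D_R_D_R.
- exact: D_R_linear.
(* In degree 0 the image is the zero cochain of degree 1. *)
- case: n c => [|m] c; first by move=> _; apply: is_cochain0.
  case: c => [[f fV] th] [/= af [/alternating_fct aV lV] mth].
  have [[mf _] [mV _]] := (af, aV).
  split=> /=; first exact: alternating_delta_g.
    split; last exact: linear_delta_V.
    by apply/alternating_fct/alternating_delta_V.
  apply: multilinearD; last exact/multilinearZ/multilinear_Omega0.
  rewrite partialE; apply: multilinear_lpd => //.
  + exact: leib_linear_l.
  + exact: leib_linear_r.
  + by move=> y e u v; rewrite linearP phi_h_linear.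
  + by move=> y e u v /=; rewrite varphi_linear linearP.
- split=> [|a]; first exact: is_cochain0.
  case: n => // m [[f fV] th] [[f' fV'] th'].
  move=> [/= af [aV lV] mth] [/= af' [aV' lV'] mth'].
  split; [exact: alternating_lincomb| |exact: multilinear_lincomb].
  split=> [v|x e u v]; first exact: (alternating_lincomb a (aV v) (aV' v)).
  rewrite -[LHS]/(a *: fV x _ + fV' x _) lV lV'.
  rewrite -[RHS]/(e *: (a *: fV x u + fV' x u) + (a *: fV x v + fV' x v)).
  by rewrite !scalerDr !scalerA (mulrC a) addrACA.
Qed.
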